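(* Fix $0<\beta<1$. For every general channel $\mathbf W$ and all reals $R_1,R_2$, \[ C_p(R_2,R_1\mid\mathbf W)=\inf_{\mathbf P}\lim_{\gamma\downarrow0}I_p(R_2-\gamma,R_1\mid\mathbf P,\mathbf W)=\inf_{\mathbf P}\sup_{\mathbf Q}\lim_{\gamma\downarrow0}J_p(R_2-\gamma,R_1\mid\mathbf P,\mathbf Q,\mathbf W), \] and for every $0\le\epsilon<1$, \[ C(\epsilon,R_1\mid\mathbf W)=\sup_{\mathbf P}I(\epsilon,R_1\mid\mathbf P,\mathbf W)=\sup_{\mathbf P}\inf_{\mathbf Q}J(\epsilon,R_1\mid\mathbf P,\mathbf Q,\mathbf W). \]
   Context: A general channel $\mathbf W=\{W^n\}_{n\ge1}$ consists of finite (or countable) sets $\mathcal X_n,\mathcal Y_n$ and distributions $W^n_x$ on $\mathcal Y_n$, $x\in\mathcal X_n$. $\mathbf P=\{P^n\}$ ranges over sequences of distributions on $\mathcal X_n$, $\mathbf Q=\{Q^n\}$ over sequences of distributions on $\mathcal Y_n$; $W^n_{P^n}=\sum_xP^n(x)W^n_x$. Logarithms natural. Define $I_p(R_2,R_1|\mathbf P,\mathbf W)=\limsup_n\sum_xP^n(x)W^n_x\{y:\frac1{n^\beta}(\log\frac{W^n_x(y)}{W^n_{P^n}(y)}-nR_1)<R_2\}$, $I(\epsilon,R_1|\mathbf P,\mathbf W)=\sup\{R_2:I_p(R_2,R_1|\mathbf P,\mathbf W)\le\epsilon\}$; $J_p(R_2,R_1|\mathbf P,\mathbf Q,\mathbf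 W)$ and $J(\epsilon,R_1|\mathbf P,\mathbf Q,\mathbf W)$ are defined identically with $W^n_{P^n}(y)$ replaced by $Q^n(y)$. A code for $W^n$ is $\Phi=(N,\phi,\{\mathcal D_i\}_{i=1}^N)$, $\phi:\{1..N\}\to\mathcal X_n$, disjoint $\mathcal D_i\subset\mathcal Y_n$; $|\Phi|=N$; $P_{e,W^n}(\Phi)=\frac1N\sum_i(1-W^n_{\phi(i)}(\mathcal D_i))$. Over all code sequences: $C_p(R_2,R_1|\mathbf W)=\inf\{\limsup_nP_{e,W^n}(\Phi_n):\liminf_n\frac1{n^\beta}(\log|\Phi_n|-nR_1)\ge R_2\}$, $C(\epsilon,R_1|\mathbf W)=\sup\{\liminf_n\frac1{n^\beta}(\log|\Phi_n|-nR_1):\limsup_nP_{e,W^n}(\Phi_n)\le\epsilon\}$. *)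

(* Defs.v *)
From Stdlib Require Import Reals List ClassicalEpsilon.
Open Scope R_scope.
Set Implicit Arguments.

Inductive ER : Type := Fin (r : R) | PInf | MInf.

Definition ER_le (x y : ER) : Prop :=
  match x, y with
  | MInf, _ => True
  | _, PInf => True
  | Fin a, Fin b => a <= b
  | _, _ => False
  end.

Definition is_ER_sup (E : ER -> Prop) (s : ER) : Prop :=
  (forall x, E x -> ER_le x s) /\
  (forall b, (forall x, E x -> ER_le x b) -> ER_le s b).
Definition is_ER_inf (E : ER -> Prop) (s : ER) : Prop :=
  (forall x, E x -> ER_le s x) /\
  (forall b, (forall x, E x -> ER_le b x) -> ER_le b s).

(* supremum / infimum in [-oo,+oo] (they always exist; chosen by epsilon) *)
Definition ER_sup (E : ER -> Prop) : ER := epsilon (inhabits MInf) (is_ER_sup E).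
Definition ER_inf (E : ER -> Prop) : ER := epsilon (inhabits PInf) (is_ER_inf E).

Definition ER_limsup (u : nat -> R) : ER :=
  ER_inf (fun t => exists N, t = ER_sup (fun v => exists n, (N <= n)%nat /\ v = Fin (u n))).
Definition ER_liminf (u : nat -> R) : ER :=
  ER_sup (fun t => exists N, t = ER_inf (fun v => exists n, (N <= n)%nat /\ v = Fin (u n))).

Definition ER_conv0p (f : R -> ER) (l : ER) : Prop :=
  match l with
  | Fin a => forall e, 0 < e -> exists d, 0 < d /\
               forall g, 0 < g < d -> exists v, f g = Fin v /\ Rabs (v - a) < e
  | PInf => forall M, exists d, 0 < d /\ forall g, 0 < g < d -> ER_le (Fin M) (f g)
  | MInf => forall M, exists d, 0 < d /\ forall g, 0 < g < d -> ER_le (f g) (Fin M)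
  end.
Definition ER_lim0p (f : R -> ER) : ER := epsilon (inhabits MInf) (ER_conv0p f).

Definition sum_list {T} (f : T -> R) (l : list T) : R :=
  fold_right (fun y acc => f y + acc) 0 l.

(* s is the sum of the nonnegative family f (sup of finite partial sums) *)
Definition has_sum {T} (f : T -> R) (s : R) : Prop :=
  is_lub (fun r => exists l : list T, NoDup l /\ r = sum_list f l) s.
Definition nnsum {T} (f : T -> R) : R := epsilon (inhabits 0) (has_sum f).

Definition ind (A : Prop) : R := if excluded_middle_informative A then 1 else 0.

Definition is_dist {T} (p : T -> R) : Prop := (forall t, 0 <= p t) /\ has_sum p 1.
Definition mass {T} (p : T -> R) (A : T -> Prop) : R := nnsum (fun t => ind (A t) * p t).

Definition countable (T : Type) : Prop :=
  exists f : T -> nat, forall a b, f a = f b -> a = b.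

(* ---------- General channel.  Index k : nat stands for blocklength n = k+1. ---------- *)
Definition blk (k : nat) : R := INR (S k).

Definition is_channel {X Y : nat -> Type} (W : forall k, X k -> Y k -> R) : Prop :=
  forall k, countable (X k) /\ countable (Y k) /\ forall x, is_dist (W k x).

Definition WP {X Y : nat -> Type} (W : forall k, X k -> Y k -> R)
  (P : forall k, X k -> R) (k : nat) (y : Y k) : R :=
  nnsum (fun x => P k x * W k x y).

(* y belongs to {y : (1/n^beta)(log (w/q) - n R1) < R2},  w = W^n_x(y), q = Q^n(y),
   with conventions log(0/q) = -oo and log(w/0) = +oo for w > 0 *)
Definition dens_below (beta : R) (k : nat) (R1 R2 w q : R) : Prop :=
  w = 0 \/ (0 < q /\ (ln (w / q) - blk k * R1) / Rpower (blk k) beta < R2).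

Definition Jp (beta : R) {X Y : nat -> Type} (W : forall k, X k -> Y k -> R)
  (R2 R1 : R) (P : forall k, X k -> R) (Q : forall k, Y k -> R) : ER :=
  ER_limsup (fun k => nnsum (fun x =>
     P k x * mass (W k x) (fun y => dens_below beta k R1 R2 (W k x y) (Q k y)))).

Definition Ip (beta : R) {X Y : nat -> Type} (W : forall k, X k -> Y k -> R)
  (R2 R1 : R) (P : forall k, X k -> R) : ER :=
  Jp beta W R2 R1 P (WP W P).

Definition Jeps (beta : R) {X Y : nat -> Type} (W : forall k, X k -> Y k -> R)
  (eps R1 : R) (P : forall k, X k -> R) (Q : forall k, Y k -> R) : ER :=
  ER_sup (fun v => exists R2, v = Fin R2 /\ ER_le (Jp beta W R2 R1 P Q) (Fin eps)).

Definition Ieps (beta : R) {X Y : nat -> Type} (W : forall k, X k -> Y k -> R)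
  (eps R1 : R) (P : forall k, X k -> R) : ER :=
  ER_sup (fun v => exists R2, v = Fin R2 /\ ER_le (Ip beta W R2 R1 P) (Fin eps)).

(* ---------- Codes: messages indexed 0..N-1 ---------- *)
Record code (A B : Type) := Code {
  csize : nat;
  cenc : nat -> A;
  cdec : nat -> B -> Prop }.

Definition valid_code {A B} (c : code A B) : Prop :=
  (1 <= csize c)%nat /\
  forall i j, (i < csize c)%nat -> (j < csize c)%nat -> i <> j ->
    forall y, ~ (cdec c i y /\ cdec c j y).

Definition Pe {A B} (Wn : A -> B -> R) (c : code A B) : R :=
  / INR (csize c) *
  sum_list (fun i => 1 - mass (Wn (cenc c i)) (cdec c i)) (seq 0 (csize c)).

Definition rate_term (beta : R) (k : nat) (R1 : R) {A B} (c : code A B) : R :=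
  (ln (INR (csize c)) - blk k * R1) / Rpower (blk k) beta.

Definition Cp (beta : R) {X Y : nat -> Type} (W : forall k, X k -> Y k -> R)
  (R2 R1 : R) : ER :=
  ER_inf (fun v => exists Phi : forall k, code (X k) (Y k),
    (forall k, valid_code (Phi k)) /\
    ER_le (Fin R2) (ER_liminf (fun k => rate_term beta k R1 (Phi k))) /\
    v = ER_limsup (fun k => Pe (W k) (Phi k))).

Definition Ceps (beta : R) {X Y : nat -> Type} (W : forall k, X k -> Y k -> R)
  (eps R1 : R) : ER :=
  ER_sup (fun v => exists Phi : forall k, code (X k) (Y k),
    (forall k, valid_code (Phi k)) /\
    ER_le (ER_limsup (fun k => Pe (W k) (Phi k))) (Fin eps) /\
    v = ER_liminf (fun k => rate_term beta k R1 (Phi k))).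

Definition is_input_seq {X : nat -> Type} (P : forall k, X k -> R) : Prop :=
  forall k, is_dist (P k).

(* Main.v *)
From Stdlib Require Import Reals List ClassicalEpsilon Classical FunctionalExtensionality ZArith Lra Lia.
Require Import Defs.
Open Scope R_scope.

(* Two one-shot bounds relate codes for a channel [W] to its information spectrum.
   Feinstein's greedy construction gives, for every input distribution [P], every
   [a > 0] and every size [N], a code with error at most [P W {W / WP < a} + N / a].
   Conversely, every code of size [N] with empirical input distribution [P] has error
   at least [P W {W / Q < a} - a / N] for every output distribution [Q].  For
   thresholds [a] and [N] whose second-order rates differ by [g > 0] the correction
   terms are of order [exp (- g n^beta)] and vanish.  As [WP] is one of the [Q]'s, both
   chains of equalities close up; only the direct part for [Cp] needs in addition a
   diagonal choice of codes along [g -> 0]. *)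

(** * Unordered sums of nonnegative families *)

Lemma ind_bounds (A : Prop) : 0 <= ind A <= 1.
Proof. unfold ind; destruct (excluded_middle_informative A); lra. Qed.

Lemma ind_true (A : Prop) : A -> ind A = 1.
Proof. unfold ind; destruct (excluded_middle_informative A); tauto. Qed.

Lemma ind_false (A : Prop) : ~ A -> ind A = 0.
Proof. unfold ind; destruct (excluded_middle_informative A); tauto. Qed.

Lemma sum_list_app {T} (f : T -> R) (l m : list T) :
  sum_list f (l ++ m) = sum_list f l + sum_list f m.
Proof. induction l as [|x l IH]; simpl; [|rewrite IH]; lra. Qed.

Lemma sum_list_le {T} (f g : T -> R) (l : list T) :
  (forall x, In x l -> f x <= g x) -> sum_list f l <= sum_list g l.
Proof.
  induction l as [|x l IH]; simpl; intros H; [lra|].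
  apply Rplus_le_compat; auto.
Qed.

Lemma sum_list_plus {T} (f g : T -> R) (l : list T) :
  sum_list (fun x => f x + g x) l = sum_list f l + sum_list g l.
Proof. induction l as [|x l IH]; simpl; [|rewrite IH]; lra. Qed.

Lemma sum_list_scal {T} (c : R) (f : T -> R) (l : list T) :
  sum_list (fun x => c * f x) l = c * sum_list f l.
Proof. induction l as [|x l IH]; simpl; [|rewrite IH]; lra. Qed.

Lemma sum_list_const {T} (c : R) (l : list T) :
  sum_list (fun _ => c) l = INR (length l) * c.
Proof.
  induction l as [|x l IH]; [simpl; lra|].
  change (c + sum_list (fun _ => c) l = INR (S (length l)) * c).
  rewrite IH, S_INR; lra.
Qed.

Lemma sum_list_nonneg {T} (f : T -> R) (l : list T) :
  (forall x, In x l -> 0 <= f x) -> 0 <= sum_list f l.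
Proof.
  intros H; apply Rle_trans with (sum_list (fun _ => 0) l);
    [rewrite sum_list_const; lra | now apply sum_list_le].
Qed.

Lemma sum_list_term_le {T} (f : T -> R) (l : list T) (x : T) :
  (forall y, 0 <= f y) -> In x l -> f x <= sum_list f l.
Proof.
  intros Hf Hx; destruct (in_split _ _ Hx) as (l1 & l2 & ->).
  rewrite sum_list_app; simpl.
  pose proof (sum_list_nonneg f l1 (fun y _ => Hf y)).
  pose proof (sum_list_nonneg f l2 (fun y _ => Hf y)); lra.
Qed.

(** Induction on [l]: its head is deleted from [m], and [NoDup] keeps the tail of [l] inside what
    remains of [m]. *)
Lemma sum_list_incl {T} (f : T -> R) (l m : list T) :
  (forall x, 0 <= f x) -> NoDup l -> incl l m -> sum_list f l <= sum_list f m.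
Proof.
  intros Hf Hl; revert m; induction Hl as [|x l Hx Hl IH]; intros m Hm; simpl.
  - now apply sum_list_nonneg.
  - destruct (in_split x m) as (m1 & m2 & ->); [apply Hm; now left|].
    rewrite sum_list_app; simpl.
    specialize (IH (m1 ++ m2)); rewrite sum_list_app in IH.
    enough (sum_list f l <= sum_list f m1 + sum_list f m2) by lra.
    apply IH; intros y Hy.
    assert (Hy' : In y (m1 ++ x :: m2)) by (apply Hm; now right).
    rewrite in_app_iff in *; simpl in Hy'.
    destruct Hy' as [?|[<-|?]]; tauto.
Qed.

Lemma sum_list_point {T} (x0 : T) (f : T -> R) (l : list T) :
  NoDup l -> sum_list (fun x => ind (x0 = x) * f x) l = ind (In x0 l) * f x0.
Proof.
  induction 1 as [|x l Hx Hl IH]; simpl.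
  - rewrite ind_false; [lra|tauto].
  - rewrite IH; destruct (classic (x0 = x)) as [<-|Hne].
    + rewrite (ind_true (x0 = x0)), (ind_false (In x0 l)), (ind_true (_ \/ _)); auto; lra.
    + rewrite (ind_false (x0 = x)) by assumption.
      destruct (classic (In x0 l)).
      * rewrite (ind_true (In x0 l)), (ind_true (_ \/ _)); auto; lra.
      * rewrite (ind_false (In x0 l)), (ind_false (_ \/ _)); auto; [lra|].
        intros [?|?]; [congruence|tauto].
Qed.

Lemma sum_list_has_sum_le {T} (f : T -> R) (s : R) (l : list T) :
  has_sum f s -> NoDup l -> sum_list f l <= s.
Proof. intros [Hub _] Hl; apply Hub; eauto. Qed.

Lemma has_sum_le_bound {T} (f : T -> R) (s M : R) :
  has_sum f s -> (forall l, NoDup l -> sum_list f l <= M) -> s <= M.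
Proof. intros [_ Hlub] H; apply Hlub; intros r (l & Hl & ->); auto. Qed.

Lemma nnsum_eq {T} (f : T -> R) (s : R) : has_sum f s -> nnsum f = s.
Proof.
  intros H; apply is_lub_u with (2 := H).
  exact (epsilon_spec (inhabits 0) (has_sum f) (ex_intro _ s H)).
Qed.

(** [nnsum] is chosen by epsilon and is meaningful only once a sum is known to exist. A uniform
    bound on the finite partial sums provides one, by completeness of the reals. *)
Lemma bounded_has_sum {T} (f : T -> R) (M : R) :
  (forall l, NoDup l -> sum_list f l <= M) -> has_sum f (nnsum f) /\ nnsum f <= M.
Proof.
  intros H.
  destruct (completeness (fun r => exists l : list T, NoDup l /\ r = sum_list f l)) as [s Hs].
  - exists M; intros r (l & Hl & ->); auto.
  - exists 0, nil; split; [constructor|reflexivity].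
  - change (has_sum f s) in Hs; rewrite (nnsum_eq _ _ Hs).
    split; [assumption | eapply has_sum_le_bound; eauto].
Qed.

Lemma has_sum_le {T} (f g : T -> R) (s t : R) :
  (forall x, f x <= g x) -> has_sum f s -> has_sum g t -> s <= t.
Proof.
  intros H Hf Hg; apply (has_sum_le_bound _ _ _ Hf); intros l Hl.
  apply Rle_trans with (sum_list g l); [now apply sum_list_le|].
  now apply sum_list_has_sum_le.
Qed.

Lemma dominated_has_sum {T} (f g : T -> R) (t : R) :
  (forall x, f x <= g x) -> has_sum g t -> has_sum f (nnsum f) /\ nnsum f <= t.
Proof.
  intros H Hg; apply bounded_has_sum; intros l Hl.
  apply Rle_trans with (sum_list g l); [now apply sum_list_le|].
  now apply sum_list_has_sum_le.
Qed.

Lemma has_sum_nonneg {T} (f : T -> R) (s : R) : has_sum f s -> 0 <= s.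
Proof.
  intros Hf; change 0 with (sum_list f nil).
  apply sum_list_has_sum_le; [assumption|constructor].
Qed.

Lemma has_sum_zero {T} : has_sum (fun _ : T => 0) 0.
Proof.
  split.
  - intros r (l & _ & ->); rewrite sum_list_const; lra.
  - intros b Hb; apply Hb; exists nil; split; [constructor|reflexivity].
Qed.

Lemma has_sum_scal {T} (f : T -> R) (c s : R) :
  0 <= c -> has_sum f s -> has_sum (fun x => c * f x) (c * s).
Proof.
  (* Leastness is proved by dividing by [c], so [c = 0] is treated apart. *)
  intros Hc Hf; destruct (Req_dec c 0) as [->|Hc0].
  - replace (fun x => 0 * f x) with (fun _ : T => 0)
      by (apply functional_extensionality; intros; ring).
    rewrite Rmult_0_l; apply has_sum_zero.
  - split.
    + intros r (l & Hl & ->); rewrite sum_list_scal.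
      apply Rmult_le_compat_l; [assumption|now apply sum_list_has_sum_le].
    + intros b Hb; apply Rmult_le_reg_l with (/ c); [apply Rinv_0_lt_compat; lra|].
      rewrite <- Rmult_assoc, Rinv_l, Rmult_1_l by assumption.
      apply (has_sum_le_bound _ _ _ Hf); intros l Hl.
      apply Rmult_le_reg_l with c; [lra|].
      rewrite <- Rmult_assoc, Rinv_r, Rmult_1_l by assumption.
      apply Hb; exists l; split; [assumption|now rewrite sum_list_scal].
Qed.

Lemma has_sum_plus {T} (f g : T -> R) (s t : R) :
  (forall x, 0 <= f x) -> (forall x, 0 <= g x) ->
  has_sum f s -> has_sum g t -> has_sum (fun x => f x + g x) (s + t).
Proof.
  intros Hf0 Hg0 Hf Hg; split.
  - intros r (l & Hl & ->); rewrite sum_list_plus.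
    apply Rplus_le_compat; now apply sum_list_has_sum_le.
  - intros b Hb.
    assert (H : forall l m, NoDup l -> NoDup m -> sum_list f l + sum_list g m <= b).
    { intros l m Hl Hm.
      (* The merged list without repetitions contains both [l] and [m]; by nonnegativity each
         partial sum can only grow on it. *)
      set (u := nodup (fun x y => excluded_middle_informative (x = y)) (l ++ m)).
      assert (Hu : NoDup u) by apply NoDup_nodup.
      assert (Hlu : incl l u)
        by (intros x Hx; apply nodup_In, in_or_app; now left).
      assert (Hmu : incl m u)
        by (intros x Hx; apply nodup_In, in_or_app; now right).
      pose proof (sum_list_incl f l u Hf0 Hl Hlu).
      pose proof (sum_list_incl g m u Hg0 Hm Hmu).
      assert (sum_list (fun x => f x + g x) u <= b) by (apply Hb; eauto).
      rewrite sum_list_plus in *; lra. }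
    enough (s <= b - t) by lra.
    apply (has_sum_le_bound _ _ _ Hf); intros l Hl.
    enough (t <= b - sum_list f l) by lra.
    apply (has_sum_le_bound _ _ _ Hg); intros m Hm.
    specialize (H l m Hl Hm); lra.
Qed.

Lemma has_sum_sum_list {T I} (f : I -> T -> R) (s : I -> R) (l : list I) :
  (forall i x, 0 <= f i x) -> (forall i, In i l -> has_sum (f i) (s i)) ->
  has_sum (fun x => sum_list (fun i => f i x) l) (sum_list s l).
Proof.
  intros Hf; induction l as [|i l IH]; intros H; simpl.
  - apply has_sum_zero.
  - apply has_sum_plus; auto.
    + intros x; now apply sum_list_nonneg.
    + apply H; now left.
    + apply IH; intros; apply H; now right.
Qed.

(** One half of Tonelli for a nonnegative double family: finitely many rows together lie below the
    column sums. Exchanging the roles of rows and columns gives the other half. *)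
Lemma has_sum_swap_le {S T} (f : S -> T -> R) (r : S -> R) (c : T -> R) (t : R) :
  (forall x y, 0 <= f x y) ->
  (forall x, has_sum (f x) (r x)) -> (forall y, has_sum (fun x => f x y) (c y)) ->
  has_sum c t -> has_sum r (nnsum r) /\ nnsum r <= t.
Proof.
  intros Hf Hr Hc Ht; apply bounded_has_sum; intros l Hl.
  eapply has_sum_le; [ | apply (has_sum_sum_list f r l); auto | exact Ht].
  intros y; exact (sum_list_has_sum_le _ _ l (Hc y) Hl).
Qed.

Lemma has_sum_point {T} (x0 : T) (f : T -> R) :
  0 <= f x0 -> has_sum (fun x => ind (x0 = x) * f x) (f x0).
Proof.
  intros H; split.
  - intros r (l & Hl & ->); rewrite sum_list_point by assumption.
    destruct (ind_bounds (In x0 l)); nra.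
  - intros b Hb; apply Hb; exists (x0 :: nil); split.
    + repeat constructor; simpl; tauto.
    + simpl; rewrite ind_true by reflexivity; ring.
Qed.

(** * Masses and averages under a distribution *)

Lemma mass_has_sum {T} (p : T -> R) (A : T -> Prop) :
  is_dist p -> has_sum (fun t => ind (A t) * p t) (mass p A).
Proof.
  intros [Hp Hs]; apply (dominated_has_sum _ p 1); [|assumption].
  intros t; destruct (ind_bounds (A t)); specialize (Hp t); nra.
Qed.

Lemma ind_mul_nonneg (A : Prop) (r : R) : 0 <= r -> 0 <= ind A * r.
Proof. destruct (ind_bounds A); nra. Qed.
#[local] Hint Resolve ind_mul_nonneg : core.

Lemma mass_bounds {T} (p : T -> R) (A : T -> Prop) : is_dist p -> 0 <= mass p A <= 1.
Proof.
  intros Hp; pose proof (mass_has_sum p A Hp) as H; split; [now apply has_sum_nonneg in H|].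
  destruct Hp as [Hp Hs]; apply (has_sum_le _ p _ _) with (2 := H) (3 := Hs).
  intros t; destruct (ind_bounds (A t)); specialize (Hp t); nra.
Qed.

(** A change of measure from [p] to [q]. It serves with [a = 1] for monotonicity, with the inverse
    threshold in Feinstein's step and with the threshold itself in the converse. *)
Lemma mass_le {T} (p q : T -> R) (a : R) (A B : T -> Prop) :
  is_dist p -> is_dist q -> 0 <= a -> (forall t, A t -> B t /\ p t <= a * q t) ->
  mass p A <= a * mass q B.
Proof.
  intros Hp Hq Ha H.
  apply (has_sum_le _ _ _ _) with
    (2 := mass_has_sum p A Hp) (3 := has_sum_scal _ _ _ Ha (mass_has_sum q B Hq)).
  intros t; destruct (classic (A t)) as [HA|HA].
  - destruct (H t HA) as [HB Hle].
    rewrite (ind_true (A t)), (ind_true (B t)) by assumption; lra.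
  - rewrite (ind_false (A t)) by assumption.
    pose proof (ind_mul_nonneg (B t) (q t) (proj1 Hq t)); nra.
Qed.

Lemma mass_incl {T} (p : T -> R) (A B : T -> Prop) :
  is_dist p -> (forall t, A t -> B t) -> mass p A <= mass p B.
Proof.
  intros Hp H; rewrite <- (Rmult_1_l (mass p B)).
  apply mass_le; auto; [lra|]; intros t HA; split; [auto|lra].
Qed.

(** Inclusion-exclusion, with the mass of the union bounded by 1. *)
Lemma mass_inter {T} (p : T -> R) (A B : T -> Prop) :
  is_dist p -> mass p A + mass p B <= 1 + mass p (fun t => A t /\ B t).
Proof.
  intros Hd; pose proof Hd as [Hp Hs].
  apply (has_sum_le (fun t => ind (A t) * p t + ind (B t) * p t)
                    (fun t => p t + ind (A t /\ B t) * p t)).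
  - intros t; specialize (Hp t); unfold ind.
    repeat destruct excluded_middle_informative; try tauto; lra.
  - apply has_sum_plus; auto using mass_has_sum.
  - apply has_sum_plus; auto using mass_has_sum.
Qed.

Lemma dist_nonempty {T} (p : T -> R) : is_dist p -> inhabited T.
Proof.
  intros [Hp Hs]; apply NNPP; intros H.
  assert (1 <= 0); [|lra].
  apply (has_sum_le_bound _ _ _ Hs); intros [|x l] _; [simpl; lra|].
  elim H; exact (inhabits x).
Qed.

(** Comparison with [c * p] shows that the averages written with [nnsum] are genuine sums. *)
Lemma average_has_sum {T} (p f : T -> R) (c : R) :
  is_dist p -> 0 <= c -> (forall x, 0 <= f x <= c) ->
  has_sum (fun x => p x * f x) (nnsum (fun x => p x * f x)).
Proof.
  intros [Hp Hs] Hc Hf; apply (dominated_has_sum _ (fun x => c * p x) (c * 1)).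
  - intros x; specialize (Hp x); specialize (Hf x); nra.
  - now apply has_sum_scal.
Qed.

(** * One-shot coding bounds: Feinstein's construction and the Verdu-Han converse *)

Section OneShot.

Context {A B : Type} (W : A -> B -> R) (HW : forall x, is_dist (W x)).

(** The one-shot form of [WP]: [WP W P k] is convertible to [output (W k) (P k)]. *)
Definition output (P : A -> R) (y : B) : R := nnsum (fun x => P x * W x y).

Lemma dist_le_1 {T} (p : T -> R) (t : T) : is_dist p -> p t <= 1.
Proof.
  intros [Hp Hs]; replace (p t) with (sum_list p (t :: nil)) by (simpl; ring).
  apply sum_list_has_sum_le; [assumption|]; repeat constructor; simpl; tauto.
Qed.

Lemma output_has_sum (P : A -> R) (y : B) :
  is_dist P -> has_sum (fun x => P x * W x y) (output P y).
Proof.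
  intros HP; apply (average_has_sum P (fun x => W x y) 1); auto; [lra|].
  intros x; split; [apply (HW x)|apply dist_le_1, HW].
Qed.

Lemma output_dist (P : A -> R) : is_dist P -> is_dist (output P).
Proof.
  intros HP; pose proof HP as [HP0 HPs].
  assert (Hpos : forall x y, 0 <= P x * W x y)
    by (intros x y; apply Rmult_le_pos; [apply HP0|apply (HW x)]).
  assert (Hrow : forall x, has_sum (fun y => P x * W x y) (P x)).
  { intros x; pose proof (has_sum_scal (W x) (P x) 1 (HP0 x) (proj2 (HW x))) as H.
    now rewrite Rmult_1_r in H. }
  split; [intros y; apply (has_sum_nonneg _ _ (output_has_sum P y HP))|].
  (* With outputs as rows: [output P] is summable, with total at most 1. *)
  destruct (has_sum_swap_le (fun y x => P x * W x y) (output P) P 1) as [Hs Hle]; auto.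
  { intros y; now apply output_has_sum. }
  (* With inputs as rows: the total of [P], which is 1, is at most that of [output P]. *)
  destruct (has_sum_swap_le (fun x y => P x * W x y) P (output P) (nnsum (output P)))
    as [_ Hge]; auto.
  { intros y; now apply output_has_sum. }
  rewrite (nnsum_eq _ _ HPs) in Hge.
  replace (nnsum (output P)) with 1 in Hs by lra; exact Hs.
Qed.

Lemma average_mass_le_output (P : A -> R) (D : B -> Prop) :
  is_dist P -> nnsum (fun x => P x * mass (W x) D) <= mass (output P) D.
Proof.
  intros HP; pose proof HP as [HP0 HPs].
  apply (has_sum_swap_le (fun x y => P x * (ind (D y) * W x y)) _
           (fun y => ind (D y) * output P y)).
  - intros x y; apply Rmult_le_pos; auto; apply ind_mul_nonneg, (HW x).
  - intros x; apply has_sum_scal; auto; now apply mass_has_sum.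
  - intros y.
    replace (fun x => P x * (ind (D y) * W x y)) with (fun x => ind (D y) * (P x * W x y))
      by (apply functional_extensionality; intros; ring).
    apply has_sum_scal; [apply ind_bounds|now apply output_has_sum].
  - apply mass_has_sum, output_dist, HP.
Qed.

(* Feinstein's greedy step: were no input [x] admissible, the inputs' good sets
   would essentially be covered by the decoding sets chosen so far, whose total
   output mass is at most [M / a]. *)
Lemma feinstein_step (P : A -> R) (low : A -> B -> Prop) (a lam : R) (M N : nat)
    (enc : nat -> A) (dec : nat -> B -> Prop) :
  is_dist P -> 0 < a ->
  (forall x y, ~ low x y -> a * output P y <= W x y) ->
  lam = nnsum (fun x => P x * mass (W x) (low x)) + INR N / a ->
  (M < N)%nat ->
  (forall i, (i < M)%nat -> forall y, dec i y -> ~ low (enc i) y) ->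
  exists x, 1 - mass (W x) (fun y => ~ low x y /\ forall i, (i < M)%nat -> ~ dec i y) <= lam.
Proof.
  intros HP Ha Hlow Hlam HMN Hdec; apply NNPP; intros Hno.
  pose proof HP as [HP0 HPs].
  set (new := fun x y => ~ low x y /\ forall i, (i < M)%nat -> ~ dec i y) in *.
  assert (Hnew : forall x, mass (W x) (new x) <= 1 - lam).
  { intros x; apply Rnot_lt_le; intros Hlt; apply Hno; exists x; unfold new in *; lra. }
  (* Nonnegativity is required to use [(1 - lam) * P x] as a summand below; any single input
     witnesses it. *)
  assert (Hlam1 : 0 <= 1 - lam).
  { destruct (dist_nonempty _ HP) as [x].
    pose proof (mass_bounds (W x) (new x) (HW x)); specialize (Hnew x); lra. }
  (* Union bound: every output is low for [x], still free and good for [x], or already in some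
     [dec i]. Averaging over [P] then yields [Htot]. *)
  assert (Hcover : forall x, 1 <= mass (W x) (low x) +
            (mass (W x) (new x) + sum_list (fun i => mass (W x) (dec i)) (seq 0 M))).
  { intros x; pose proof (HW x) as [HW0 HW1].
    apply (has_sum_le (W x) (fun y => ind (low x y) * W x y +
      (ind (new x y) * W x y + sum_list (fun i => ind (dec i y) * W x y) (seq 0 M)))).
    - intros y; specialize (HW0 y).
      assert (Hs : forall i, 0 <= ind (dec i y) * W x y) by auto.
      pose proof (sum_list_nonneg _ (seq 0 M) (fun i _ => Hs i)).
      pose proof (ind_mul_nonneg (low x y) _ HW0).
      pose proof (ind_mul_nonneg (new x y) _ HW0).
      destruct (classic (low x y)) as [Hl|Hl]; [rewrite (ind_true (low x y)) in * by auto; lra|].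
      destruct (classic (new x y)) as [Hn|Hn]; [rewrite (ind_true (new x y)) in * by auto; lra|].
      assert (Hi : exists i, (i < M)%nat /\ dec i y).
      { apply NNPP; intros Hi; apply Hn; split; [assumption|].
        intros i Hi1 Hi2; apply Hi; eauto. }
      destruct Hi as (i & Hi & Hd).
      assert (Hin : In i (seq 0 M)) by (apply in_seq; lia).
      pose proof (sum_list_term_le _ _ i Hs Hin) as Ht.
      simpl in Ht; rewrite (ind_true (dec i y) Hd) in Ht; lra.
    - assumption.
    - apply has_sum_plus; auto.
      + intros y; apply Rplus_le_le_0_compat; auto using sum_list_nonneg.
      + now apply mass_has_sum.
      + apply has_sum_plus; auto using mass_has_sum.
        * intros y; auto using sum_list_nonneg.
        * apply (has_sum_sum_list (fun i y => ind (dec i y) * W x y)); auto using mass_has_sum. }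
  assert (Hmass : forall x D, 0 <= P x * mass (W x) D)
    by (intros x D; apply Rmult_le_pos; [apply HP0|apply mass_bounds, HW]).
  assert (Hsum : forall D : A -> B -> Prop, has_sum (fun x => P x * mass (W x) (D x))
                   (nnsum (fun x => P x * mass (W x) (D x)))).
  { intros D; apply average_has_sum with 1; auto; [lra|]; intros x; now apply mass_bounds. }
  assert (Htot : 1 <= nnsum (fun x => P x * mass (W x) (low x)) +
     ((1 - lam) * 1 + sum_list (fun i => nnsum (fun x => P x * mass (W x) (dec i))) (seq 0 M))).
  { apply (has_sum_le P (fun x => P x * mass (W x) (low x) + ((1 - lam) * P x +
       sum_list (fun i => P x * mass (W x) (dec i)) (seq 0 M)))).
    - intros x; rewrite sum_list_scal.
      specialize (HP0 x); specialize (Hnew x); specialize (Hcover x); nra.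
    - assumption.
    - apply has_sum_plus; auto.
      + intros x; apply Rplus_le_le_0_compat; [now apply Rmult_le_pos|].
        auto using sum_list_nonneg.
      + apply has_sum_plus.
        * intros x; now apply Rmult_le_pos.
        * intros x; auto using sum_list_nonneg.
        * now apply has_sum_scal.
        * apply (has_sum_sum_list (fun i x => P x * mass (W x) (dec i))); auto. }
  (* Outputs in [dec i] are good for [enc i], so there [output P] is at most [W (enc i) / a]. Each
     decoding set therefore uses up output mass at most [/ a]. *)
  assert (Hcov : sum_list (fun i => nnsum (fun x => P x * mass (W x) (dec i))) (seq 0 M)
                 <= INR M * / a).
  { replace (INR M * / a) with (sum_list (fun _ => / a) (seq 0 M))
      by now rewrite sum_list_const, length_seq.
    apply sum_list_le; intros i Hi; apply in_seq in Hi.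
    apply Rle_trans with (mass (output P) (dec i)); [now apply average_mass_le_output|].
    assert (mass (output P) (dec i) <= / a * mass (W (enc i)) (dec i)).
    { apply mass_le; auto using output_dist.
      - left; now apply Rinv_0_lt_compat.
      - intros y Hy; split; [assumption|].
        apply Rmult_le_reg_l with a; [assumption|].
        rewrite <- Rmult_assoc, Rinv_r, Rmult_1_l by lra.
        apply Hlow, Hdec; [lia|assumption]. }
    destruct (mass_bounds (W (enc i)) (dec i) (HW _)).
    assert (0 < / a) by now apply Rinv_0_lt_compat. nra. }
  unfold Rdiv in Hlam.
  (* The strictness of [M < N] is what contradicts [Htot]. *)
  assert (INR M * / a < INR N * / a).
  { apply Rmult_lt_compat_r; [now apply Rinv_0_lt_compat|now apply lt_INR]. }
  lra.
Qed.

Lemma Pe_le (c : code A B) (lam : R) :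
  (1 <= csize c)%nat ->
  (forall i, (i < csize c)%nat -> 1 - mass (W (cenc c i)) (cdec c i) <= lam) ->
  Pe W c <= lam.
Proof.
  intros Hc H; assert (HN : 0 < INR (csize c)) by (apply lt_0_INR; lia).
  unfold Pe; apply Rmult_le_reg_l with (INR (csize c)); [assumption|].
  rewrite <- Rmult_assoc, Rinv_r, Rmult_1_l by lra.
  replace (INR (csize c) * lam) with (sum_list (fun _ => lam) (seq 0 (csize c)))
    by now rewrite sum_list_const, length_seq.
  apply sum_list_le; intros i Hi; apply in_seq in Hi; apply H; lia.
Qed.

(** Codewords are added one at a time. Besides disjointness and the error bound, the induction keeps
    every decoding set within the good outputs of its codeword, which is what the next greedy step
    requires. Each single message has error at most [lam], hence so does the average. *)
Lemma feinstein (P : A -> R) (low : A -> B -> Prop) (a : R) (N : nat) :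
  is_dist P -> 0 < a -> (1 <= N)%nat ->
  (forall x y, ~ low x y -> a * output P y <= W x y) ->
  exists c : code A B, valid_code c /\ csize c = N /\
    Pe W c <= nnsum (fun x => P x * mass (W x) (low x)) + INR N / a.
Proof.
  intros HP Ha HN Hlow.
  set (lam := nnsum (fun x => P x * mass (W x) (low x)) + INR N / a).
  assert (H : forall M, (M <= N)%nat -> exists enc dec,
    (forall i j y, (i < M)%nat -> (j < M)%nat -> i <> j -> ~ (dec i y /\ dec j y)) /\
    (forall i, (i < M)%nat -> forall y, dec i y -> ~ low (enc i) y) /\
    (forall i, (i < M)%nat -> 1 - mass (W (enc i)) (dec i) <= lam)).
  { induction M as [|M IH]; intros HM.
    - destruct (dist_nonempty _ HP) as [x]; exists (fun _ => x), (fun _ _ => False).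
      repeat split; intros; lia.
    - destruct IH as (enc & dec & Hdisj & Hdec & Hlam); [lia|].
      destruct (feinstein_step P low a lam M N enc dec) as [x Hx]; auto.
      (* The new codeword receives all of its good outputs that are still free, so disjointness
         persists. *)
      set (new := fun y => ~ low x y /\ forall i, (i < M)%nat -> ~ dec i y) in Hx.
      exists (fun i => if Nat.eqb i M then x else enc i),
             (fun i => if Nat.eqb i M then new else dec i).
      repeat split.
      + intros i j y Hi Hj Hij.
        destruct (Nat.eqb_spec i M), (Nat.eqb_spec j M); try lia.
        * intros [[_ Hn] Hy]; apply (Hn j); [lia|assumption].
        * intros [Hy [_ Hn]]; apply (Hn i); [lia|assumption].
        * apply Hdisj; lia.
      + intros i Hi y; destruct (Nat.eqb_spec i M); [now intros [? _]|].
        apply Hdec; lia.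
      + intros i Hi; destruct (Nat.eqb_spec i M); [assumption|].
        apply Hlam; lia. }
  destruct (H N (le_n N)) as (enc & dec & Hdisj & _ & Hlam).
  exists (Code N enc dec); repeat split; simpl; auto.
  now apply Pe_le.
Qed.

Lemma trivial_code (x : A) :
  exists c : code A B, valid_code c /\ csize c = 1%nat /\ Pe W c <= 0.
Proof.
  exists (Code 1 (fun _ => x) (fun _ _ => True)); repeat split; simpl; try lia.
  apply Pe_le; simpl; [lia|]; intros i _.
  assert (H : has_sum (fun y => ind True * W x y) 1).
  { rewrite <- (Rmult_1_l 1), <- (ind_true True I).
    apply has_sum_scal; [apply ind_bounds|]. rewrite (ind_true True I). apply (HW x). }
  unfold mass; rewrite (nnsum_eq _ _ H); lra.
Qed.

Definition empirical (c : code A B) (x : A) : R :=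
  / INR (csize c) * sum_list (fun i => ind (cenc c i = x)) (seq 0 (csize c)).

(** Averaging over [empirical c] is averaging over messages, repeated codewords being counted with
    multiplicity. *)
Lemma empirical_has_sum (c : code A B) (f : A -> R) :
  (1 <= csize c)%nat -> (forall x, 0 <= f x) ->
  has_sum (fun x => empirical c x * f x)
          (/ INR (csize c) * sum_list (fun i => f (cenc c i)) (seq 0 (csize c))).
Proof.
  intros Hc Hf; assert (HN : 0 < INR (csize c)) by (apply lt_0_INR; lia).
  replace (fun x => empirical c x * f x) with (fun x => / INR (csize c) *
    sum_list (fun i => ind (cenc c i = x) * f x) (seq 0 (csize c))).
  - apply has_sum_scal; [left; now apply Rinv_0_lt_compat|].
    apply (has_sum_sum_list (fun i x => ind (cenc c i = x) * f x)); auto.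
    intros i _; now apply has_sum_point.
  - apply functional_extensionality; intros x; unfold empirical.
    rewrite Rmult_assoc; f_equal; rewrite (Rmult_comm (sum_list _ _)), <- sum_list_scal.
    f_equal; apply functional_extensionality; intros i; ring.
Qed.

Lemma empirical_dist (c : code A B) : (1 <= csize c)%nat -> is_dist (empirical c).
Proof.
  intros Hc; assert (HN : 0 < INR (csize c)) by (apply lt_0_INR; lia).
  split.
  - intros x; apply Rmult_le_pos; [left; now apply Rinv_0_lt_compat|].
    apply sum_list_nonneg; intros; apply ind_bounds.
  - pose proof (empirical_has_sum c (fun _ => 1) Hc (fun _ => Rle_0_1)) as H.
    cbv beta in H; rewrite sum_list_const, length_seq, Rmult_1_r, Rinv_l in H by lra.
    replace (empirical c) with (fun x => empirical c x * 1); [exact H|].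
    apply functional_extensionality; intros; ring.
Qed.

(** At each output at most one of the indicators is 1, so their sum times [q] stays below [q]. *)
Lemma disjoint_mass_le (q : B -> R) (D : nat -> B -> Prop) (N : nat) :
  is_dist q ->
  (forall i j, (i < N)%nat -> (j < N)%nat -> i <> j -> forall y, ~ (D i y /\ D j y)) ->
  sum_list (fun i => mass q (D i)) (seq 0 N) <= 1.
Proof.
  intros Hd Hdisj; pose proof Hd as [Hq Hs].
  apply (has_sum_le (fun y => sum_list (fun i => ind (D i y) * q y) (seq 0 N)) q); auto.
  - intros y; specialize (Hq y).
    replace (fun i => ind (D i y) * q y) with (fun i => q y * ind (D i y))
      by (apply functional_extensionality; intros; ring).
    rewrite sum_list_scal.
    enough (sum_list (fun i => ind (D i y)) (seq 0 N) <= 1) by nra.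
    destruct (classic (exists i, (i < N)%nat /\ D i y)) as [(i & Hi & HD)|Hno].
    + apply Rle_trans with (sum_list (fun j => ind (i = j) * 1) (seq 0 N)).
      * apply sum_list_le; intros j Hj; apply in_seq in Hj.
        destruct (classic (i = j)) as [<-|Hne].
        -- rewrite (ind_true (i = i)) by reflexivity; destruct (ind_bounds (D i y)); lra.
        -- rewrite (ind_false (D j y)), (ind_false (i = j)) by
             (try assumption; intros Hj2; apply (Hdisj i j Hi) with (y := y); auto; lia).
           lra.
      * rewrite sum_list_point by apply seq_NoDup.
        destruct (ind_bounds (In i (seq 0 N))); lra.
    + apply Rle_trans with (sum_list (fun _ => 0) (seq 0 N)); [|rewrite sum_list_const; lra].
      apply sum_list_le; intros j Hj; apply in_seq in Hj.
      rewrite ind_false; [lra|]; intros HD; apply Hno; exists j; split; [lia|assumption].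
  - apply (has_sum_sum_list (fun i y => ind (D i y) * q y)); auto using mass_has_sum.
Qed.

(* Verdu-Han: on a decoding set, the part where [W x <= a q] contributes at most
   [a] times its [q]-mass, and the decoding sets have total [q]-mass at most 1. *)
Lemma converse (c : code A B) (q : B -> R) (low : A -> B -> Prop) (a : R) :
  valid_code c -> is_dist q -> 0 <= a ->
  (forall x y, low x y -> W x y <= a * q y) ->
  nnsum (fun x => empirical c x * mass (W x) (low x)) <= Pe W c + a / INR (csize c).
Proof.
  intros [Hc Hdisj] Hq Ha Hlow.
  assert (HN : 0 < INR (csize c)) by (apply lt_0_INR; lia).
  rewrite (nnsum_eq _ _ (empirical_has_sum c (fun x => mass (W x) (low x)) Hc
                           (fun x => proj1 (mass_bounds _ _ (HW x))))).
  unfold Pe, Rdiv; rewrite (Rmult_comm a), <- Rmult_plus_distr_l.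
  apply Rmult_le_compat_l; [left; now apply Rinv_0_lt_compat|].
  apply Rle_trans with (sum_list (fun i => (1 - mass (W (cenc c i)) (cdec c i)) +
                          a * mass q (cdec c i)) (seq 0 (csize c))).
  - apply sum_list_le; intros i _.
    (* This charges the low outputs outside the decoding set to the error of message [i]; only the
       low part inside it remains to be bounded. *)
    pose proof (mass_inter (W (cenc c i)) (low (cenc c i)) (cdec c i) (HW _)).
    enough (mass (W (cenc c i)) (fun y => low (cenc c i) y /\ cdec c i y)
            <= a * mass q (cdec c i)) by lra.
    apply mass_le; auto; intros y [Hl Hy]; auto.
  - rewrite sum_list_plus, sum_list_scal.
    pose proof (disjoint_mass_le q (cdec c) (csize c) Hq Hdisj); nra.
Qed.

End OneShot.

(** * Extended reals *)

Lemma ER_le_trans (x y z : ER) : ER_le x y -> ER_le y z -> ER_le x z.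
Proof. destruct x, y, z; simpl; intros; try tauto; lra. Qed.

Lemma ER_le_antisym (x y : ER) : ER_le x y -> ER_le y x -> x = y.
Proof. destruct x, y; simpl; intros; try tauto; f_equal; lra. Qed.

(** Real upper bounds determine the order, so comparisons with a limsup reduce to finite bounds,
    where [limsup_le_iff] applies. *)
Lemma ER_le_of_upper_reals (x y : ER) :
  (forall c, ER_le y (Fin c) -> ER_le x (Fin c)) -> ER_le x y.
Proof.
  destruct y as [r| |]; intros H.
  - apply H; simpl; lra.
  - destruct x; exact I.
  - destruct x as [r| |]; [|exact (H 0 I)|exact I].
    specialize (H (r - 1) I); simpl in *; lra.
Qed.

Lemma ER_le_of_lower_reals (x y : ER) :
  (forall c, ER_le (Fin c) x -> ER_le (Fin c) y) -> ER_le x y.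
Proof.
  destruct x as [r| |]; intros H.
  - apply H; simpl; lra.
  - destruct y as [r| |]; [|exact I|exact (H 0 I)].
    specialize (H (r + 1) I); simpl in *; lra.
  - destruct y; exact I.
Qed.

Lemma ER_le_upper_slack (x : ER) (c : R) :
  (forall e, 0 < e -> ER_le x (Fin (c + e))) -> ER_le x (Fin c).
Proof.
  destruct x as [r| |]; simpl; intros H; [|exact (H 1 Rlt_0_1)|exact I].
  apply le_epsilon; auto.
Qed.

Lemma ER_le_lower_slack (x : ER) (c : R) :
  (forall e, 0 < e -> ER_le (Fin (c - e)) x) -> ER_le (Fin c) x.
Proof.
  destruct x as [r| |]; simpl; intros H; [|exact I|exact (H 1 Rlt_0_1)].
  apply le_epsilon; intros e He; specialize (H e He); lra.
Qed.

Lemma ER_sup_exists (E : ER -> Prop) : exists s, is_ER_sup E s.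
Proof.
  destruct (classic (exists M, forall x, E x -> ER_le x (Fin M))) as [[M HM]|Hunb].
  - destruct (classic (exists r, E (Fin r))) as [[r0 Hr0]|Hno].
    + destruct (completeness (fun r => E (Fin r))) as [s [Hub Hlub]].
      * exists M; intros r Hr; exact (HM _ Hr).
      * now exists r0.
      * exists (Fin s); split.
        -- intros [r| |] Hx; [exact (Hub r Hx)|exact (HM _ Hx)|exact I].
        -- intros [b| |] Hb; [|exact I|exact (Hb _ Hr0)].
           apply Hlub; intros r Hr; exact (Hb _ Hr).
    + exists MInf; split; [|intros; exact I].
      intros [r| |] Hx; [elim Hno; eauto|exact (HM _ Hx)|exact I].
  - exists PInf; split; [intros [r| |] _; exact I|].
    intros [b| |] Hb; [elim Hunb; eauto|exact I|].
    elim Hunb; exists 0; intros x Hx; apply ER_le_trans with (1 := Hb x Hx); exact I.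
Qed.

Lemma ER_sup_spec (E : ER -> Prop) : is_ER_sup E (ER_sup E).
Proof. exact (epsilon_spec (inhabits MInf) (is_ER_sup E) (ER_sup_exists E)). Qed.

Lemma ER_inf_spec (E : ER -> Prop) : is_ER_inf E (ER_inf E).
Proof.
  apply (epsilon_spec (inhabits PInf) (is_ER_inf E)).
  (* The infimum is obtained as the supremum of all lower bounds. *)
  destruct (ER_sup_exists (fun b => forall x, E x -> ER_le b x)) as [s [Hub Hlub]].
  exists s; split; [|exact Hub].
  intros x Hx; apply Hlub; auto.
Qed.

Lemma ER_le_sup (E : ER -> Prop) (x : ER) : E x -> ER_le x (ER_sup E).
Proof. apply ER_sup_spec. Qed.

Lemma ER_sup_le (E : ER -> Prop) (b : ER) :
  (forall x, E x -> ER_le x b) -> ER_le (ER_sup E) b.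
Proof. apply ER_sup_spec. Qed.

Lemma ER_inf_le (E : ER -> Prop) (x : ER) : E x -> ER_le (ER_inf E) x.
Proof. apply ER_inf_spec. Qed.

Lemma ER_le_inf (E : ER -> Prop) (b : ER) :
  (forall x, E x -> ER_le b x) -> ER_le b (ER_inf E).
Proof. apply ER_inf_spec. Qed.

Lemma limsup_le_iff (u : nat -> R) (c : R) :
  ER_le (ER_limsup u) (Fin c) <->
  forall e, 0 < e -> exists N, forall n, (N <= n)%nat -> u n <= c + e.
Proof.
  split.
  - intros H e He; apply NNPP; intros Hno.
    assert (Hle : ER_le (Fin (c + e)) (ER_limsup u)).
    { apply ER_le_inf; intros x [N ->]; apply NNPP; intros Hx; apply Hno; exists N.
      intros n Hn; apply Rnot_lt_le; intros Hlt; apply Hx.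
      apply ER_le_trans with (Fin (u n)); [simpl; lra|].
      apply ER_le_sup; eauto. }
    pose proof (ER_le_trans _ _ _ Hle H); simpl in *; lra.
  - intros H; apply ER_le_upper_slack; intros e He; destruct (H e He) as [N HN].
    eapply ER_le_trans; [apply ER_inf_le; exists N; reflexivity|].
    apply ER_sup_le; intros x (n & Hn & ->); exact (HN n Hn).
Qed.

Lemma le_liminf_iff (u : nat -> R) (c : R) :
  ER_le (Fin c) (ER_liminf u) <->
  forall e, 0 < e -> exists N, forall n, (N <= n)%nat -> c - e <= u n.
Proof.
  split.
  - intros H e He; apply NNPP; intros Hno.
    assert (Hle : ER_le (ER_liminf u) (Fin (c - e))).
    { apply ER_sup_le; intros x [N ->]; apply NNPP; intros Hx; apply Hno; exists N.
      intros n Hn; apply Rnot_lt_le; intros Hlt; apply Hx.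
      apply ER_le_trans with (Fin (u n)); [|simpl; lra].
      apply ER_inf_le; eauto. }
    pose proof (ER_le_trans _ _ _ H Hle); simpl in *; lra.
  - intros H; apply ER_le_lower_slack; intros e He; destruct (H e He) as [N HN].
    eapply ER_le_trans; [|apply ER_le_sup; exists N; reflexivity].
    apply ER_le_inf; intros x (n & Hn & ->); exact (HN n Hn).
Qed.

(** * Right limits at 0 of nonincreasing extended-real functions *)

Section MonotoneLimit.

Context (f : R -> ER) (Hf : forall g h, 0 < g <= h -> ER_le (f h) (f g)).

(** Values increase as [g] decreases to 0, so they converge to their supremum. This is the existence
    fact that gives [ER_lim0p] its meaning. *)
Lemma conv0p_sup : ER_conv0p f (ER_sup (fun v => exists g, 0 < g /\ v = f g)).
Proof.
  assert (Hub : forall g, 0 < g -> ER_le (f g) (ER_sup (fun v => exists g, 0 < g /\ v = f g)))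
    by (intros g Hg; apply ER_le_sup; eauto).
  assert (Hlub : forall b, (forall g, 0 < g -> ER_le (f g) b) ->
                 ER_le (ER_sup (fun v => exists g, 0 < g /\ v = f g)) b)
    by (intros b Hb; apply ER_sup_le; intros x (g & Hg & ->); auto).
  destruct (ER_sup (fun v => exists g, 0 < g /\ v = f g)) as [a| |]; cbn [ER_conv0p].
  - intros e He.
    assert (Hd : exists d, 0 < d /\ ~ ER_le (f d) (Fin (a - e))).
    { apply NNPP; intros Hno.
      assert (Hb : ER_le (Fin a) (Fin (a - e))); [|simpl in Hb; lra].
      apply Hlub; intros g Hg; apply NNPP; intros Hn; apply Hno; eauto. }
    destruct Hd as (d & Hd & Hda); exists d; split; [assumption|]; intros g Hg.
    specialize (Hub g (proj1 Hg)); assert (Hgd : ER_le (f d) (f g)) by (apply Hf; lra).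
    destruct (f g) as [v| |]; simpl in Hub.
    + exists v; split; [reflexivity|].
      destruct (f d); simpl in *; try tauto; apply Rabs_def1; lra.
    + tauto.
    + destruct (f d); simpl in *; tauto.
  - intros M; apply NNPP; intros Hno; apply (Hlub (Fin M)); intros d Hd.
    apply NNPP; intros HM; apply Hno; exists d; split; [assumption|]; intros g Hg.
    apply ER_le_trans with (f d); [|apply Hf; lra].
    destruct (f d); simpl in *; try tauto; lra.
  - intros M; exists 1; split; [lra|]; intros g Hg.
    apply ER_le_trans with (1 := Hub g (proj1 Hg)); exact I.
Qed.

(** [ER_lim0p] is some limit picked by epsilon; identifying every limit with the supremum makes the
    pick unambiguous. *)
Lemma conv0p_is_sup (l : ER) :
  ER_conv0p f l -> is_ER_sup (fun v => exists g, 0 < g /\ v = f g) l.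
Proof.
  intros Hl; split.
  - intros x (g & Hg & ->); destruct l as [a| |]; cbn [ER_conv0p] in Hl.
    + apply ER_le_upper_slack; intros e He; destruct (Hl e He) as (d & Hd & H).
      (* The point [Rmin g (d / 2)] lies in the range of the limit estimate and is at most [g], so
         monotonicity transfers the estimate to [g]. *)
      pose proof (Rmin_l g (d / 2)); pose proof (Rmin_r g (d / 2)).
      assert (0 < Rmin g (d / 2)) by (apply Rmin_glb_lt; lra).
      destruct (H (Rmin g (d / 2))) as (v & Hv & Hva); [lra|].
      apply ER_le_trans with (Fin v); [rewrite <- Hv; apply Hf; lra|].
      apply Rabs_def2 in Hva; simpl; lra.
    + destruct (f g); exact I.
    + apply ER_le_of_upper_reals; intros M _; destruct (Hl M) as (d & Hd & H).
      pose proof (Rmin_l g (d / 2)); pose proof (Rmin_r g (d / 2)).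
      assert (0 < Rmin g (d / 2)) by (apply Rmin_glb_lt; lra).
      apply ER_le_trans with (f (Rmin g (d / 2))); [apply Hf; lra|apply H; lra].
  - intros b Hb.
    assert (Hb' : forall g, 0 < g -> ER_le (f g) b) by (intros g Hg; apply Hb; eauto).
    destruct l as [a| |]; cbn [ER_conv0p] in Hl.
    + apply ER_le_lower_slack; intros e He; destruct (Hl e He) as (d & Hd & H).
      destruct (H (d / 2)) as (v & Hv & Hva); [lra|].
      apply ER_le_trans with (f (d / 2)); [|apply Hb'; lra].
      rewrite Hv; apply Rabs_def2 in Hva; simpl; lra.
    + apply ER_le_of_lower_reals; intros M _; destruct (Hl M) as (d & Hd & H).
      apply ER_le_trans with (f (d / 2)); [apply H|apply Hb']; lra.
    + exact I.
Qed.

Lemma lim0p_le_iff (t : ER) :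
  ER_le (ER_lim0p f) t <-> forall g, 0 < g -> ER_le (f g) t.
Proof.
  assert (H : ER_conv0p f (ER_lim0p f)) by (apply (epsilon_spec (inhabits MInf) (ER_conv0p f)); eexists; exact conv0p_sup).
  apply conv0p_is_sup in H; destruct H as [Hub Hlub]; split.
  - intros Ht g Hg; apply ER_le_trans with (2 := Ht); eauto.
  - intros Hg; apply Hlub; intros x (g & H & ->); auto.
Qed.

End MonotoneLimit.

(** * Information density at block length [n = k + 1] *)

(* The likelihood ratio at which the normalised log-likelihood ratio equals [R2]. *)
Definition threshold (beta : R) (k : nat) (R1 R2 : R) : R :=
  exp (blk k * R1 + Rpower (blk k) beta * R2).

Lemma threshold_pos (beta : R) (k : nat) (R1 R2 : R) : 0 < threshold beta k R1 R2.
Proof. apply exp_pos. Qed.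

Lemma Rpower_pos (x y : R) : 0 < Rpower x y.
Proof. apply exp_pos. Qed.

Lemma normalized_lt_iff (t d r s : R) : 0 < s -> (t - d) / s < r <-> t < d + s * r.
Proof.
  intros Hs; assert (E : (t - d) / s * s = t - d) by (field; lra).
  split; intros H; nra.
Qed.

(** For [w = 0] the bound is immediate. For [w > 0] the convention on [q = 0] leaves only [q > 0],
    where the logarithmic inequality exponentiates. *)
Lemma dens_below_le (beta : R) (k : nat) (R1 R2 w q : R) :
  0 <= w -> 0 <= q -> dens_below beta k R1 R2 w q -> w <= threshold beta k R1 R2 * q.
Proof.
  intros Hw Hq H; pose proof (threshold_pos beta k R1 R2).
  destruct Hw as [Hw| <-]; [|now apply Rmult_le_pos; [lra|]].
  destruct H as [H|[Hq0 H]]; [lra|].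
  apply normalized_lt_iff in H; [|apply Rpower_pos].
  apply exp_increasing in H; rewrite exp_ln in H by now apply Rdiv_lt_0_compat.
  unfold threshold; apply Rmult_le_reg_r with (/ q); [now apply Rinv_0_lt_compat|].
  rewrite Rmult_assoc, Rinv_r by lra; unfold Rdiv in H; lra.
Qed.

Lemma le_of_not_dens_below (beta : R) (k : nat) (R1 R2 w q : R) :
  0 <= w -> 0 <= q -> ~ dens_below beta k R1 R2 w q -> threshold beta k R1 R2 * q <= w.
Proof.
  intros Hw Hq H; destruct Hq as [Hq| <-]; [|lra].
  destruct Hw as [Hw| <-]; [|elim H; now left].
  apply Rnot_lt_le; intros Hlt; apply H; right; split; [assumption|].
  apply normalized_lt_iff; [apply Rpower_pos|].
  rewrite <- (ln_exp (_ + _)); apply ln_increasing; [now apply Rdiv_lt_0_compat|].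
  apply Rmult_lt_reg_r with q; [assumption|].
  unfold Rdiv; rewrite Rmult_assoc, Rinv_l by lra; unfold threshold in Hlt; lra.
Qed.

Lemma dens_below_mono (beta : R) (k : nat) (R1 R2 R2' w q : R) :
  R2 <= R2' -> dens_below beta k R1 R2 w q -> dens_below beta k R1 R2' w q.
Proof. intros HR [H|[Hq H]]; [now left|right; split; lra]. Qed.

Lemma threshold_ratio (beta : R) (k : nat) (R1 R2 R2' : R) :
  threshold beta k R1 R2 / threshold beta k R1 R2' =
  exp (- ((R2' - R2) * Rpower (blk k) beta)).
Proof. unfold threshold, Rdiv; rewrite <- exp_Ropp, <- exp_plus; f_equal; ring. Qed.

Lemma rate_ge_iff (beta : R) (k : nat) (R1 r : R) {A B} (c : code A B) :
  (1 <= csize c)%nat -> r <= rate_term beta k R1 c <-> threshold beta k R1 r <= INR (csize c).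
Proof.
  intros Hc; assert (HN : 0 < INR (csize c)) by (apply lt_0_INR; lia).
  assert (H : rate_term beta k R1 c < r <-> INR (csize c) < threshold beta k R1 r).
  { unfold rate_term, threshold; rewrite normalized_lt_iff by apply Rpower_pos; split; intros H.
    - rewrite <- (exp_ln (INR _)) by assumption; now apply exp_increasing.
    - rewrite <- (ln_exp (_ + _)); now apply ln_increasing. }
  split; intros; apply Rnot_lt_le; intros Hlt; apply H in Hlt; lra.
Qed.

(** Since [beta > 0], the power [n^beta] tends to infinity. The factor 2 allows for rounding up the
    code size in [code_exists]. *)
Lemma exp_power_vanish (beta g e : R) :
  0 < beta -> 0 < g -> 0 < e ->
  exists K, forall k, (K <= k)%nat -> 2 * exp (- (g * Rpower (blk k) beta)) <= e.
Proof.
  intros Hb Hg He.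
  (* Once [n^beta >= M], the exponent [g * n^beta] is at least [- ln (e / 2)]; the maximum with 1
     makes [M] positive, so that [M = exp (ln M)]. *)
  set (M := Rmax 1 (- ln (e / 2) / g)).
  destruct (INR_unbounded (exp (ln M / beta))) as [K HK].
  exists K; intros k Hk.
  assert (HM1 : 1 <= M) by apply Rmax_l.
  assert (HM2 : - ln (e / 2) / g <= M) by apply Rmax_r.
  assert (HkK : INR K <= blk k) by (apply le_INR; lia).
  assert (Hpow : M <= Rpower (blk k) beta).
  { rewrite <- (exp_ln M) by lra; left; apply exp_increasing.
    assert (H : ln M / beta < ln (blk k)).
    { rewrite <- (ln_exp (ln M / beta)); apply ln_increasing; [apply exp_pos|lra]. }
    apply Rmult_lt_compat_l with (r := beta) in H; [|assumption].
    replace (beta * (ln M / beta)) with (ln M) in H by (field; lra); exact H. }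
  assert (- ln (e / 2) <= g * Rpower (blk k) beta).
  { replace (- ln (e / 2)) with (g * (- ln (e / 2) / g)) by (field; lra); nra. }
  assert (exp (- (g * Rpower (blk k) beta)) <= exp (ln (e / 2))).
  { destruct (Rle_lt_or_eq_dec (- (g * Rpower (blk k) beta)) (ln (e / 2))) as [Hlt|Heq];
      [lra|left; now apply exp_increasing|rewrite Heq; lra]. }
  rewrite exp_ln in *; lra.
Qed.

(** [J] tends to infinity, but slowly enough that [k] has already passed the starting point of the
    property with index [J k]. *)
Lemma diagonal (A : nat -> nat -> Prop) :
  (forall j, exists K, forall k, (K <= k)%nat -> A j k) ->
  exists J : nat -> nat,
    forall j, exists K, forall k, (K <= k)%nat -> (j <= J k)%nat /\ A (J k) k.
Proof.
  intros H; destruct (choice _ H) as [K HK].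
  (* [pick k n] is the largest index in [1..n] whose starting point [K] is at most [k], with default
     0. *)
  set (pick := fun k => fix pick n := match n with
    | O => O | S m => if Nat.leb (K (S m)) k then S m else pick m end).
  assert (Hpick : forall k n, (pick k n = 0 \/ K (pick k n) <= k)%nat).
  { intros k n; induction n as [|n IH]; simpl; [now left|].
    destruct (Nat.leb_spec (K (S n)) k); [now right|exact IH]. }
  assert (Hmax : forall k n j, (j <= n -> K j <= k -> j <= pick k n)%nat).
  { intros k n; induction n as [|n IH]; simpl; intros j Hj HKj; [lia|].
    destruct (Nat.leb_spec (K (S n)) k) as [Hle|Hlt]; [lia|].
    apply IH; [|assumption].
    destruct (Nat.eq_dec j (S n)) as [->|]; lia. }
  (* The bound includes [j] so that the search up to [k] reaches it, and [K 0] so that the default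
     index is valid too. *)
  exists (fun k => pick k k); intros j; exists (Nat.max j (Nat.max (K j) (K 0%nat))).
  intros k Hk; split; [apply Hmax; lia|].
  apply HK; destruct (Hpick k k) as [->|]; lia.
Qed.

(** * Coding theorems *)

Section Channel.

Context (beta : R) (Hbeta : 0 < beta) {X Y : nat -> Type}
  (W : forall k, X k -> Y k -> R) (HW : is_channel W).

Lemma channel_dist (k : nat) (x : X k) : is_dist (W k x).
Proof. apply (HW k). Qed.

Lemma WP_dist (P : forall k, X k -> R) : is_input_seq P -> is_input_seq (WP W P).
Proof. intros HP k; exact (output_dist (W k) (channel_dist k) (P k) (HP k)). Qed.

(** This makes [Jp] at [R2 - g] nonincreasing in [g], as the limit lemmas require. *)
Lemma Jp_mono (R1 R2 R2' : R) (P : forall k, X k -> R) (Q : forall k, Y k -> R) :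
  is_input_seq P -> R2 <= R2' -> ER_le (Jp beta W R2 R1 P Q) (Jp beta W R2' R1 P Q).
Proof.
  intros HP HR; apply ER_le_of_upper_reals; intros c; unfold Jp; rewrite !limsup_le_iff.
  intros H e He; destruct (H e He) as [N HN]; exists N; intros k Hk.
  apply Rle_trans with (2 := HN k Hk).
  apply (has_sum_le _ _ _ _) with
    (2 := average_has_sum _ _ 1 (HP k) Rle_0_1 (fun x => mass_bounds _ _ (channel_dist k x)))
    (3 := average_has_sum _ _ 1 (HP k) Rle_0_1 (fun x => mass_bounds _ _ (channel_dist k x))).
  intros x; apply Rmult_le_compat_l; [apply (HP k)|].
  apply mass_incl; [apply channel_dist|]; intros y; now apply dens_below_mono.
Qed.

Lemma lim_Jp_le_iff (R1 R2 : R) (P : forall k, X k -> R) (Q : forall k, Y k -> R) (t : ER) :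
  is_input_seq P ->
  ER_le (ER_lim0p (fun g => Jp beta W (R2 - g) R1 P Q)) t <->
  forall g, 0 < g -> ER_le (Jp beta W (R2 - g) R1 P Q) t.
Proof.
  intros HP; apply (lim0p_le_iff (fun g => Jp beta W (R2 - g) R1 P Q)).
  intros g h Hgh; apply Jp_mono; [assumption|lra].
Qed.

(* A threshold below 1 asks for no more than one message, and then the error is 0. *)
Lemma code_exists (R1 R2 g : R) (P : forall k, X k -> R) (k : nat) :
  is_input_seq P -> 0 < g ->
  exists c : code (X k) (Y k), valid_code c /\ R2 - g <= rate_term beta k R1 c /\
    Pe (W k) c <= nnsum (fun x => P k x * mass (W k x)
                    (fun y => dens_below beta k R1 R2 (W k x y) (WP W P k y))) +
                  2 * exp (- (g * Rpower (blk k) beta)).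
Proof.
  intros HP Hg; set (T := threshold beta k R1 (R2 - g)).
  destruct (Rle_or_lt T 1) as [HT|HT].
  - destruct (dist_nonempty _ (HP k)) as [x].
    destruct (trivial_code (W k) (channel_dist k) x) as (c & Hc & Hsize & HPe).
    exists c; split; [assumption|]; split.
    + apply rate_ge_iff; [apply Hc|]; rewrite Hsize; exact HT.
    + apply Rle_trans with (1 := HPe).
      pose proof (exp_pos (- (g * Rpower (blk k) beta))).
      apply Rplus_le_le_0_compat; [|lra].
      apply (has_sum_nonneg (fun x => P k x * mass (W k x)
               (fun y => dens_below beta k R1 R2 (W k x y) (WP W P k y)))).
      apply average_has_sum with 1; [apply HP|lra|].
      intros z; apply mass_bounds, channel_dist.
  - destruct (archimed T) as [Hup1 Hup2].
    assert (Hz : (0 < up T)%Z) by (apply lt_IZR; lra).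
    (* Here [T < N <= T + 1 < 2 * T] because [T > 1]; this is the origin of the factor 2. *)
    set (N := Z.to_nat (up T)).
    assert (HN : INR N = IZR (up T)) by (unfold N; rewrite INR_IZR_INZ, Z2Nat.id by lia; reflexivity).
    destruct (feinstein (W k) (channel_dist k) (P k)
      (fun x y => dens_below beta k R1 R2 (W k x y) (WP W P k y))
      (threshold beta k R1 R2) N) as (c & Hc & Hsize & HPe).
    + apply HP.
    + apply threshold_pos.
    + lia.
    + intros x y; apply le_of_not_dens_below; [apply (channel_dist k x)|].
      apply (WP_dist P HP k).
    + exists c; split; [assumption|]; split.
      * apply rate_ge_iff; [apply Hc|]; rewrite Hsize, HN; fold T; lra.
      * apply Rle_trans with (1 := HPe); apply Rplus_le_compat_l.
        replace g with (R2 - (R2 - g)) at 1 by ring.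
        rewrite <- (threshold_ratio beta k R1); fold T.
        unfold Rdiv; rewrite <- Rmult_assoc; apply Rmult_le_compat_r; [|lra].
        left; apply Rinv_0_lt_compat, threshold_pos.
Qed.

Lemma achievability (R1 R2 g c : R) (P : forall k, X k -> R) :
  is_input_seq P -> 0 < g -> ER_le (Ip beta W R2 R1 P) (Fin c) ->
  exists Phi : forall k, code (X k) (Y k),
    (forall k, valid_code (Phi k)) /\
    (forall k, R2 - g <= rate_term beta k R1 (Phi k)) /\
    ER_le (ER_limsup (fun k => Pe (W k) (Phi k))) (Fin c).
Proof.
  intros HP Hg Hc.
  set (Phi := fun k => constructive_indefinite_description _ (code_exists R1 R2 g P k HP Hg)).
  exists (fun k => proj1_sig (Phi k)).
  assert (H := fun k => proj2_sig (Phi k)).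
  split; [intros k; apply H|]; split; [intros k; apply H|].
  apply limsup_le_iff; intros e He.
  apply limsup_le_iff with (e := e / 2) in Hc; [|lra]; destruct Hc as [N1 HN1].
  destruct (exp_power_vanish beta g (e / 2)) as [N2 HN2]; [assumption..|lra|].
  exists (Nat.max N1 N2); intros k Hk.
  destruct (H k) as (_ & _ & HPe).
  specialize (HN1 k ltac:(lia)); specialize (HN2 k ltac:(lia)); lra.
Qed.

Lemma converse_limsup (R1 r g c : R) (Phi : forall k, code (X k) (Y k))
    (Q : forall k, Y k -> R) :
  (forall k, valid_code (Phi k)) -> is_input_seq Q -> 0 < g ->
  ER_le (Fin r) (ER_liminf (fun k => rate_term beta k R1 (Phi k))) ->
  ER_le (ER_limsup (fun k => Pe (W k) (Phi k))) (Fin c) ->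
  ER_le (Jp beta W (r - g) R1 (fun k => empirical (Phi k)) Q) (Fin c).
Proof.
  intros HPhi HQ Hg Hr Hc; apply limsup_le_iff; intros e He.
  (* Half of [g] absorbs the slack of the liminf; the other half separates the thresholds, so that
     their ratio vanishes. *)
  apply le_liminf_iff with (e := g / 2) in Hr; [|lra]; destruct Hr as [N1 HN1].
  apply limsup_le_iff with (e := e / 2) in Hc; [|lra]; destruct Hc as [N2 HN2].
  destruct (exp_power_vanish beta (g / 2) (e / 2)) as [N3 HN3]; [assumption|lra..|].
  exists (Nat.max N1 (Nat.max N2 N3)); intros k Hk.
  specialize (HN1 k ltac:(lia)); specialize (HN2 k ltac:(lia)); specialize (HN3 k ltac:(lia)).
  pose proof (threshold_pos beta k R1 (r - g)) as Hpos.
  eapply Rle_trans;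
    [apply (converse (W k) (channel_dist k) (Phi k) (Q k)
             (fun x y => dens_below beta k R1 (r - g) (W k x y) (Q k y))
             (threshold beta k R1 (r - g))); auto; [lra|]|].
  { intros x y; apply dens_below_le; [apply (channel_dist k x)|apply (HQ k)]. }
  apply rate_ge_iff in HN1; [|apply HPhi].
  assert (threshold beta k R1 (r - g) / INR (csize (Phi k)) <=
          threshold beta k R1 (r - g) / threshold beta k R1 (r - g / 2)).
  { apply Rmult_le_compat_l; [lra|]; apply Rinv_le_contravar; [apply threshold_pos|assumption]. }
  rewrite threshold_ratio in *.
  replace (r - g / 2 - (r - g)) with (g / 2) in * by field.
  pose proof (exp_pos (- (g / 2 * Rpower (blk k) beta))); lra.
Qed.

Lemma Cp_le_lim_Ip (R1 R2 : R) (P : forall k, X k -> R) :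
  is_input_seq P ->
  ER_le (Cp beta W R2 R1) (ER_lim0p (fun g => Ip beta W (R2 - g) R1 P)).
Proof.
  intros HP; apply ER_le_of_upper_reals; intros c Hc.
  assert (Hlim : forall g, 0 < g -> ER_le (Ip beta W (R2 - g) R1 P) (Fin c))
    by now apply lim_Jp_le_iff.
  set (s := fun j => / INR (S j)).
  assert (Hs : forall j, 0 < s j) by (intros j; apply Rinv_0_lt_compat, lt_0_INR; lia).
  assert (Hs0 : forall e, 0 < e -> exists j0, forall j, (j0 <= j)%nat -> s j <= e).
  { intros e He; destruct (archimed_cor1 e He) as (n & Hn & Hn0).
    exists n; intros j Hj; left; apply Rle_lt_trans with (2 := Hn).
    apply Rinv_le_contravar; [now apply lt_0_INR|apply le_INR; lia]. }
  (* The slack [s j] is spent twice, in approaching the limit and in constructing the code, so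
     sequence [j] has rate at least [R2 - 2 * s j]. *)
  set (Phi := fun j => constructive_indefinite_description _
    (achievability R1 (R2 - s j) (s j) c P HP (Hs j) (Hlim _ (Hs j)))).
  assert (H := fun j => proj2_sig (Phi j)); cbv beta in H.
  (* Moving slowly from one sequence to the next gives a single sequence whose rate loss and excess
     error both vanish. *)
  destruct (diagonal (fun j k => Pe (W k) (proj1_sig (Phi j) k) <= c + s j)) as [J HJ].
  { intros j; destruct (H j) as (_ & _ & HPe); rewrite limsup_le_iff in HPe; auto. }
  set (Psi := fun k => proj1_sig (Phi (J k)) k).
  apply ER_le_trans with (ER_limsup (fun k => Pe (W k) (Psi k))).
  - apply ER_inf_le; exists Psi; split; [intros k; apply H|]; split; [|reflexivity].
    apply le_liminf_iff; intros e He.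
    destruct (Hs0 (e / 2)) as [j0 Hj0]; [lra|].
    destruct (HJ j0) as [K HK]; exists K; intros k Hk.
    destruct (HK k Hk) as [Hj _]; specialize (Hj0 _ Hj).
    destruct (H (J k)) as (_ & Hrate & _); specialize (Hrate k); unfold Psi; lra.
  - apply limsup_le_iff; intros e He.
    destruct (Hs0 e He) as [j0 Hj0].
    destruct (HJ j0) as [K HK]; exists K; intros k Hk.
    destruct (HK k Hk) as [Hj HPe]; specialize (Hj0 _ Hj); unfold Psi; lra.
Qed.

Lemma lim_Ip_le_sup_lim_Jp (R1 R2 : R) (P : forall k, X k -> R) :
  is_input_seq P ->
  ER_le (ER_lim0p (fun g => Ip beta W (R2 - g) R1 P))
        (ER_sup (fun u => exists Q, is_input_seq Q /\
           u = ER_lim0p (fun g => Jp beta W (R2 - g) R1 P Q))).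
Proof. intros HP; apply ER_le_sup; exists (WP W P); split; [now apply WP_dist|reflexivity]. Qed.

(** The empirical input distributions depend only on the codes, so one [P] serves against every
    [Q]. *)
Lemma inf_sup_lim_Jp_le_Cp (R1 R2 : R) :
  ER_le (ER_inf (fun v => exists P, is_input_seq P /\
           v = ER_sup (fun u => exists Q, is_input_seq Q /\
                 u = ER_lim0p (fun g => Jp beta W (R2 - g) R1 P Q))))
        (Cp beta W R2 R1).
Proof.
  apply ER_le_inf; intros v (Phi & HPhi & Hrate & ->).
  assert (HE : is_input_seq (fun k => empirical (Phi k)))
    by (intros k; apply empirical_dist, HPhi).
  eapply ER_le_trans; [apply ER_inf_le; eexists; split; [exact HE|reflexivity]|].
  apply ER_sup_le; intros u (Q & HQ & ->).
  apply lim_Jp_le_iff; [assumption|]; intros g Hg.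
  apply ER_le_of_upper_reals; intros c Hc; now apply converse_limsup.
Qed.

Lemma Ieps_le_Ceps (R1 eps : R) (P : forall k, X k -> R) :
  is_input_seq P -> ER_le (Ieps beta W eps R1 P) (Ceps beta W eps R1).
Proof.
  intros HP; apply ER_sup_le; intros v (R2 & -> & HR2).
  (* The supremum in [Ceps] tolerates an arbitrarily small rate loss, so one code sequence per [g]
     suffices. *)
  apply ER_le_lower_slack; intros g Hg.
  destruct (achievability R1 R2 g eps P HP Hg HR2) as (Phi & HPhi & Hrate & HPe).
  apply ER_le_trans with (ER_liminf (fun k => rate_term beta k R1 (Phi k))).
  - apply le_liminf_iff; intros e He; exists 0%nat; intros k _; specialize (Hrate k); lra.
  - apply ER_le_sup; exists Phi; auto.
Qed.

Lemma inf_Jeps_le_Ieps (R1 eps : R) (P : forall k, X k -> R) :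
  is_input_seq P ->
  ER_le (ER_inf (fun u => exists Q, is_input_seq Q /\ u = Jeps beta W eps R1 P Q))
        (Ieps beta W eps R1 P).
Proof. intros HP; apply ER_inf_le; exists (WP W P); split; [now apply WP_dist|reflexivity]. Qed.

Lemma Ceps_le_sup_inf_Jeps (R1 eps : R) :
  ER_le (Ceps beta W eps R1)
        (ER_sup (fun v => exists P, is_input_seq P /\
           v = ER_inf (fun u => exists Q, is_input_seq Q /\ u = Jeps beta W eps R1 P Q))).
Proof.
  apply ER_sup_le; intros v (Phi & HPhi & HPe & ->).
  apply ER_le_of_lower_reals; intros r Hr.
  eapply ER_le_trans; [|apply ER_le_sup; exists (fun k => empirical (Phi k)); split;
    [intros k; apply empirical_dist, HPhi|reflexivity]].
  apply ER_le_inf; intros u (Q & HQ & ->).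
  apply ER_le_lower_slack; intros g Hg.
  (* XX *)
  apply ER_le_sup; exists (r - g); split; [reflexivity|now apply converse_limsup].
Qed.

End Channel.

Theorem theorem4 (beta : R) (X Y : nat -> Type) (W : forall k, X k -> Y k -> R) :
  0 < beta < 1 ->
  is_channel W ->
  (forall R1 R2 : R,
     Cp beta W R2 R1 =
       ER_inf (fun v => exists P, is_input_seq P /\
                 v = ER_lim0p (fun g => Ip beta W (R2 - g) R1 P)) /\
     ER_inf (fun v => exists P, is_input_seq P /\
                 v = ER_lim0p (fun g => Ip beta W (R2 - g) R1 P)) =
       ER_inf (fun v => exists P, is_input_seq P /\
                 v = ER_sup (fun u => exists Q, is_input_seq Q /\
                        u = ER_lim0p (fun g => Jp beta W (R2 - g) R1 P Q)))) /\
  (forall R1 eps : R, 0 <= eps < 1 ->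
     Ceps beta W eps R1 =
       ER_sup (fun v => exists P, is_input_seq P /\ v = Ieps beta W eps R1 P) /\
     ER_sup (fun v => exists P, is_input_seq P /\ v = Ieps beta W eps R1 P) =
       ER_sup (fun v => exists P, is_input_seq P /\
                 v = ER_inf (fun u => exists Q, is_input_seq Q /\
                        u = Jeps beta W eps R1 P Q))).
Proof.
  intros [Hbeta _] HW; split; intros R1.
  - intros R2.
    match goal with |- ?x = ?y /\ ?y = ?z =>
      assert (Hxy : ER_le x y); [|assert (Hyz : ER_le y z); [|assert (Hzx : ER_le z x)]] end.
    + apply ER_le_inf; intros v (P & HP & ->); now apply Cp_le_lim_Ip.
    + apply ER_le_inf; intros v (P & HP & ->).
      eapply ER_le_trans; [apply ER_inf_le; exists P; split; [exact HP|reflexivity]|].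
      now apply lim_Ip_le_sup_lim_Jp.
    + now apply inf_sup_lim_Jp_le_Cp.
    + split; apply ER_le_antisym; eauto using ER_le_trans.
  - intros eps _.
    match goal with |- ?x = ?y /\ ?y = ?z =>
      assert (Hyx : ER_le y x); [|assert (Hzy : ER_le z y); [|assert (Hxz : ER_le x z)]] end.
    + apply ER_sup_le; intros v (P & HP & ->); now apply Ieps_le_Ceps.
    + apply ER_sup_le; intros v (P & HP & ->).
      eapply ER_le_trans; [now apply inf_Jeps_le_Ieps|].
      apply ER_le_sup; exists P; split; [exact HP|reflexivity].
    + now apply Ceps_le_sup_inf_Jeps.
    + split; apply ER_le_antisym; eauto using ER_le_trans.
Qed.
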